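(* The number of independent binary invariants (basis tensors) at a given order does not scale with the number $N$ of particles. There are only seven binary invariants at lowest order (rank-two tensors) for any value of $N$, and twenty-three at next order (rank-three tensors) independent of $N$ (except when $N$ is quite small, when the number is even lower). The sets of unlabeled graphs labelling them are as follows. Rank two: - $\mathbb{G}_{rr}$ has 2 graphs: two loops at one vertex; two loops at two different vertices. - $\mathbb{G}_{\gamma r}$ has 2 graphs: an edge with a loop at one endpoint; an edge and a disjoint loop. - $\mathbb{G}_{\gamma\gamma}$ has 3 graphs: a double edge; two edges sharing one vertex; two disjoint edges. Rank three: - $\mathbb{G}_{rrr}$ has 3 graphs: three loops at one vertex; two loops at one vertex and one loop at another; three loops at three different vertices. - $\mathbb{G}_{\gamma rr}$ has 5 graphs: an edge with two loops at one endpoint; an edge with one loop at each endpoint; an edge with one loop at an endpoint, and a disjoint loop; an edge and a disjoint vertex with two loops; an edge and two disjoint loops at different vertices. - $\mathbb{G}_{\gamma\gamma r}$ has 7 graphs: a double edge with a loop at an endpoint; a double edge and a disjoint loop; a two-edge path with a loop at the middle vertex; a two-edge path with a loop at an end vertex; a two-edge path and a disjoint loop; two disjoint edges with a loop at an endpoint of one of them; two disjoint edges and a disjoint loop. - $\mathbb{G}_{\gamma\gamma\gamma}$ has 8 graphs: a triple edge; a triangle; a double edge with a further edge attached at one of its endpoints; a star of three edges; a three-edge path; a double edge and a disjoint edge; a two-edge path and a disjoint edge; three disjoint edges.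
   Context: Let $V=\{1,\dots,N\}$ (particle labels) and $E=\{(ij): 1\le i<j\le N\}$, where $(ij)$ is identified with the unordered pair $\{i,j\}$. An index of type $r$ ranges over $V$ (a ''single index'') and an index of type $\gamma$ ranges over $E$ (a ''double index''). A tensor in the block of type $X_1\ldots X_n$ (each $X_k$ being $r$ or $\gamma$) is a real array $Q_{\nu_1,\dots,\nu_n}$ in which $\nu_k$ is an index of type $X_k$; its rank is $n$. Such tensors appear as coefficients in a perturbation expansion of an $N$-particle Hamiltonian. Rank-two tensors occur at lowest (harmonic) order and rank-three tensors at the next order. Graphs are finite undirected loop multigraphs (loops and multiple edges allowed). To each multi-index of a tensor element associate the graph having one vertex for each distinct particle label occurring in it, one edge joining $i$ and $j$ for each double index $(ij)$, and one loop at $i$ for each single index $i$ (counted with multiplicity). Two graphs are isomorphic if they have the same number of vertices and edges, connected in the same way. An unlabeled graph is an isomorphism class, and $\mathbb{G}_{X_1\ldots X_n}$ is the set of unlabeled graphs for the block. For $\mathcal{G}\in\mathbb{G}_{X_1\ldots X_n}$, the binary invariant $B(\mathcal{G})$ is the tensor in the block whose element at a multi-index is $1$ if the graph associated with that multi-index belongs to the class $\mathcal{G}$, and $0$ otherwise. Thus there is one binary invariant for each element of $\mathbb{G}_{X_1\ldots X_n}$. *)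

(* Defs.v *)
From HB Require Import structures.
From mathcomp Require Import all_boot all_order all_algebra finmap.
From mathcomp Require Import boolp classical_sets cardinality reals.

Set Implicit Arguments.
Unset Strict Implicit.
Unset Printing Implicit Defensive.

Import GRing.Theory.

Local Open Scope ring_scope.
Local Open Scope classical_set_scope.

(** Finite undirected loop multigraphs, on the vertex set [{0, ..., order - 1}]:
    [adj x y] is the number of edges joining [x] and [y], and [adj x x] is the
    number of loops at [x], each loop being counted once.  As graphs are only
    considered up to isomorphism, fixing the vertex set loses nothing, and it
    keeps [multigraph] in a universe small enough for [set multigraph]. *)
Record multigraph := Multigraph {
  order : nat;
  adj : 'I_order -> 'I_order -> nat;
  adj_sym : forall x y, adj x y = adj y x }.

(** Preserving all multiplicities also preserves the number of edges. *)
Definition isomorphic (G H : multigraph) : Prop :=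
  exists2 f : 'I_(order G) -> 'I_(order H),
    bijective f & forall x y, adj (f x) (f y) = adj x y.

Definition unlabeled (G : multigraph) : set multigraph :=
  [set H | isomorphic G H].

Section GraphOfEdges.
Variables (T : eqType) (s : seq (T * T)).

Definition endpoints : seq T := flatten [seq [:: e.1; e.2] | e <- s].

Definition multiplicity (x y : T) : nat :=
  count [pred e | (e == (x, y)) || (e == (y, x))] s.

Lemma multiplicity_sym (x y : T) : multiplicity x y = multiplicity y x.
Proof. by apply: eq_count => e /=; rewrite orbC. Qed.

(** The graph given by a list of edges, [(x, x)] being a loop at [x]; it has
    one vertex for each distinct label that occurs in the list. *)
Definition graph_of_edges : multigraph :=
  let label := tnth (in_tuple (undup endpoints)) in
  @Multigraph (size (undup endpoints))
    (fun x y => multiplicity (label x) (label y))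
    (fun x y => multiplicity_sym (label x) (label y)).

End GraphOfEdges.

Variant index_type := Single | Double.

Definition index_type_to_bool (X : index_type) : bool :=
  if X is Double then true else false.
Definition bool_to_index_type (b : bool) : index_type :=
  if b then Double else Single.
Lemma index_type_to_boolK : cancel index_type_to_bool bool_to_index_type.
Proof. by case. Qed.
HB.instance Definition _ :=
  Equality.copy index_type (can_type index_type_to_boolK).

Notation double_index N := {e : 'I_N * 'I_N | (e.1 < e.2)%N}.

Notation index N := ('I_N + double_index N)%type.

Definition type_of_index (N : nat) (i : index N) : index_type :=
  if i is inr _ then Double else Single.

Definition edge_of_index (N : nat) (i : index N) : 'I_N * 'I_N :=
  match i with inl i => (i, i) | inr e => val e end.

(** A block [X_1 ... X_n] is given by the sequence of its index types. *)
Definition multi_index (N : nat) (X : seq index_type) : finType :=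
  {nu : (size X).-tuple (index N) | map (@type_of_index N) nu == X}.

Definition tensor (R : realType) (N : nat) (X : seq index_type) : vectType R :=
  {ffun multi_index N X -> R^o}.

Definition graph_of_index (N : nat) (X : seq index_type)
    (nu : multi_index N X) : multigraph :=
  graph_of_edges (map (@edge_of_index N) (val nu)).

Definition unlabeled_graphs (N : nat) (X : seq index_type) :
    set (set multigraph) :=
  range (fun nu : multi_index N X => unlabeled (graph_of_index nu)).

Definition binary_invariant (R : realType) (N : nat) (X : seq index_type)
    (C : set multigraph) : tensor R N X :=
  [ffun nu : multi_index N X => (graph_of_index nu \in C)%:R].

(** The set is finite because [multi_index N X] is. *)
Definition binary_invariants (R : realType) (N : nat) (X : seq index_type) :
    {fset tensor R N X} :=
  fset_set [set binary_invariant R N X C | C in unlabeled_graphs N X].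

(** The blocks of rank [n] are those with [k] double indices followed by
    [n - k] single ones, as [k] ranges over [0, ..., n]. *)
Definition block (n k : nat) : seq index_type :=
  nseq k Double ++ nseq (n - k) Single.

Definition num_independent (R : realType) (N n : nat) : nat :=
  (\sum_(k < n.+1) \dim <<binary_invariants R N (block n k)>>%VS)%N.

(** [A] consists of the unlabeled graphs listed in [L], which are pairwise
    distinct, leaving out those with more than [N] vertices: they cannot occur
    with only [N] particle labels. *)
Definition labelled_by (N : nat) (A : set (set multigraph))
    (L : seq (seq (nat * nat))) : Prop :=
  [/\ uniq L,
      {in L &, forall s t,
        isomorphic (graph_of_edges s) (graph_of_edges t) -> s = t}
    & A = [set unlabeled (graph_of_edges s)
            | s in [set s | s \in L /\ (order (graph_of_edges s) <= N)%N]]].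

Local Open Scope nat_scope.

Definition graphs_rr : seq (seq (nat * nat)) :=
  [:: [:: (1, 1); (1, 1)];
      [:: (1, 1); (2, 2)] ].

Definition graphs_gr : seq (seq (nat * nat)) :=
  [:: [:: (1, 2); (1, 1)];
      [:: (1, 2); (3, 3)] ].

Definition graphs_gg : seq (seq (nat * nat)) :=
  [:: [:: (1, 2); (1, 2)];
      [:: (1, 2); (2, 3)];
      [:: (1, 2); (3, 4)] ].

Definition graphs_rrr : seq (seq (nat * nat)) :=
  [:: [:: (1, 1); (1, 1); (1, 1)];
      [:: (1, 1); (1, 1); (2, 2)];
      [:: (1, 1); (2, 2); (3, 3)] ].

Definition graphs_grr : seq (seq (nat * nat)) :=
  [:: [:: (1, 2); (1, 1); (1, 1)];
      [:: (1, 2); (1, 1); (2, 2)];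
      [:: (1, 2); (1, 1); (3, 3)];
      [:: (1, 2); (3, 3); (3, 3)];
      [:: (1, 2); (3, 3); (4, 4)] ].

Definition graphs_ggr : seq (seq (nat * nat)) :=
  [:: [:: (1, 2); (1, 2); (1, 1)];
      [:: (1, 2); (1, 2); (3, 3)];
      [:: (1, 2); (2, 3); (2, 2)];
      [:: (1, 2); (2, 3); (1, 1)];
      [:: (1, 2); (2, 3); (4, 4)];
      [:: (1, 2); (3, 4); (1, 1)];
      [:: (1, 2); (3, 4); (5, 5)] ].

Definition graphs_ggg : seq (seq (nat * nat)) :=
  [:: [:: (1, 2); (1, 2); (1, 2)];
      [:: (1, 2); (2, 3); (1, 3)];
      [:: (1, 2); (1, 2); (2, 3)];
      [:: (1, 2); (1, 3); (1, 4)];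
      [:: (1, 2); (2, 3); (3, 4)];
      [:: (1, 2); (1, 2); (3, 4)];
      [:: (1, 2); (2, 3); (4, 5)];
      [:: (1, 2); (3, 4); (5, 6)] ].

(* Main.v *)
Require Import Defs.
From mathcomp Require Import all_boot all_order all_algebra finmap.
From mathcomp Require Import boolp classical_sets cardinality reals.

(** Distinct binary invariants of a block have disjoint nonempty supports, so they
    are independent, and the dimension of their span is the number of unlabeled
    graphs of the block.  An unlabeled graph occurs with [N] labels as soon as it
    occurs with some number of labels and has at most [N] vertices.  The graphs of
    rank [n] have at most [2 n] vertices, so the count is constant for [2 n <= N];
    it is smaller for [N < 2 n], where the [n] disjoint edges are missing.

    For the explicit lists, renaming the labels in their order of appearance turns
    every list of edges into one of finitely many patterns, each of which is found
    among those of the listed graphs after permuting and reorienting the edges; a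
    numerical isomorphism invariant shows that the listed graphs are distinct. *)

Set Implicit Arguments.
Unset Strict Implicit.
Unset Printing Implicit Defensive.

Import GRing.Theory.

(** * Isomorphism of multigraphs and a numerical invariant *)

Lemma isomorphic_refl G : isomorphic G G.
Proof. by exists id => //; exists id. Qed.

Lemma isomorphic_sym G H : isomorphic G H -> isomorphic H G.
Proof.
case=> f [g fK gK] adjf; exists g; first by exists f.
by move=> x y; rewrite -adjf !gK.
Qed.

Lemma isomorphic_trans H G K :
  isomorphic G H -> isomorphic H K -> isomorphic G K.
Proof.
case=> f bij_f adjf [g bij_g adjg]; exists (g \o f); first exact: bij_comp.
by move=> x y; rewrite adjg adjf.
Qed.

Lemma unlabeledP G H : unlabeled G = unlabeled H <-> isomorphic G H.
Proof.
split=> [eqGH | isoGH].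
  have : unlabeled H H by exact: isomorphic_refl.
  by rewrite -eqGH.
apply/seteqP; split=> K; last exact: isomorphic_trans.
by apply: isomorphic_trans; exact: isomorphic_sym.
Qed.

Lemma isomorphic_order G H : isomorphic G H -> Defs.order G = Defs.order H.
Proof. by case=> f /bij_eq_card; rewrite !card_ord. Qed.

(* Degrees with a loop counted twice are not enough to separate the graphs of a
   block; replacing the multiplicities of edges by their squares is. *)
Definition graph_invariant (G : multigraph) : nat * nat :=
  (Defs.order G, \sum_x (adj x x + \sum_(y : 'I_(Defs.order G)) adj x y ^ 2) ^ 2).

Lemma isomorphic_invariant G H :
  isomorphic G H -> graph_invariant G = graph_invariant H.
Proof.
move=> isoGH; congr (_, _); first exact: isomorphic_order.
have [f bij_f adjf] := isoGH; rewrite [RHS](reindex f); last exact: onW_bij.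
apply: eq_bigr => x _; rewrite adjf; congr ((_ + _) ^ 2).
rewrite [RHS](reindex f); last exact: onW_bij.
by apply: eq_bigr => y _; rewrite adjf.
Qed.

(** * Edge lists, their reorientations and rearrangements *)

Section EdgeLists.
Variable T : eqType.
Implicit Types (s t : seq (T * T)) (e : T * T).

(** The list form of [graph_invariant], with sums over label lists in place of sums over ordinals,
    so that [vm_compute] can evaluate it. *)
Definition edges_invariant s : nat * nat :=
  let labels := undup (endpoints s) in
  (size labels,
   sumn [seq (multiplicity s x x
              + sumn [seq multiplicity s x y ^ 2 | y <- labels]) ^ 2
        | x <- labels]).

Lemma graph_of_edges_invariant s :
  graph_invariant (graph_of_edges s) = edges_invariant s.
Proof.
rewrite /edges_invariant /graph_invariant; congr (_, _).
rewrite sumnE big_map [RHS]big_tnth; apply: eq_bigr => x _.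
by rewrite sumnE big_map [in RHS]big_tnth.
Qed.

Lemma endpoints_edge s e : e \in s -> (e.1 \in endpoints s) && (e.2 \in endpoints s).
Proof.
move=> es; apply/andP; split; apply/flattenP; exists [:: e.1; e.2];
  by rewrite ?inE ?eqxx ?orbT //; apply/mapP; exists e.
Qed.

Definition same_edge e e' := (e == e') || (e == (e'.2, e'.1)).

Lemma same_edge_endpoints s t :
  all2 same_edge s t -> endpoints s =i endpoints t.
Proof.
elim: s t => [|[a b] s IH] [|[c d] t] //= /andP[sab /IH eqst] x.
rewrite /endpoints /= !inE eqst; case/orP: sab => /eqP[-> ->] //.
by rewrite orbCA.
Qed.

Lemma same_edge_multiplicity s t :
  all2 same_edge s t -> multiplicity s =2 multiplicity t.
Proof.
move=> + x y; elim: s t => [|[a b] s IH] [|[c d] t] //= /andP[sab /IH].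
rewrite /multiplicity /= => ->; congr (nat_of_bool _ + _).
case/orP: sab => /eqP[-> ->] //.
by rewrite /= !xpair_eqE orbC andbC [in X in _ || X]andbC.
Qed.

Fixpoint orientations s : seq (seq (T * T)) :=
  if s is e :: s' then
    [seq f :: t | f <- [:: e; (e.2, e.1)], t <- orientations s']
  else [:: [::]].

Lemma mem_orientations s t : t \in orientations s -> all2 same_edge t s.
Proof.
elim: s t => [|e s IH] t; first by rewrite inE => /eqP->.
case/allpairsP => -[f u] /= [+ /IH us ->] /=; rewrite us andbT.
by rewrite !inE => /orP[] /eqP->; rewrite /same_edge eqxx ?orbT.
Qed.

Definition edge_type e : index_type := if e.1 == e.2 then Single else Double.

Definition rearrangements s : seq (seq (T * T)) :=
  flatten [seq orientations t | t <- permutations s].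

End EdgeLists.

(** * Isomorphisms between graphs of edge lists *)

Lemma perm_undup_map (T U : eqType) (f : T -> U) (s : seq T) :
  {in s &, injective f} -> perm_eq (undup (map f s)) (map f (undup s)).
Proof.
move=> inj_f; apply: uniq_perm; rewrite ?undup_uniq //.
  rewrite map_inj_in_uniq ?undup_uniq // => x y.
  by rewrite !mem_undup; exact: inj_f.
by move=> y; rewrite mem_undup; apply: eq_mem_map => x; rewrite mem_undup.
Qed.

(** Common source of the isomorphisms obtained by relabelling, reorienting and permuting edges. The
    endpoints of [t] are constrained only as a set, because reordering edges changes the numbering
    of the vertices. *)
Lemma isomorphic_map (T U : eqType) (f : T -> U) s t :
    {in endpoints s &, injective f} ->
    endpoints t =i map f (endpoints s) ->
    {in endpoints s &, forall x y,
       multiplicity t (f x) (f y) = multiplicity s x y} ->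
  isomorphic (graph_of_edges s) (graph_of_edges t).
Proof.
move=> inj_f eq_t mult_t.
set a := undup (endpoints s); set b := undup (endpoints t).
have perm_b : perm_eq b (map f a).
  apply: perm_trans (perm_undup_map inj_f).
  by apply: uniq_perm; rewrite ?undup_uniq // => x; rewrite !mem_undup.
pose la := tnth (in_tuple a); pose lb := tnth (in_tuple b).
have la_s i : la i \in endpoints s by rewrite -mem_undup mem_tnth.
have mem_b i : f (la i) \in b.
  by rewrite (perm_mem perm_b) map_f // mem_undup.
have lt_b i : (index (f (la i)) b < size b)%N by rewrite index_mem.
(* A vertex is a position in the duplicate-free list of labels; [g] sends the position of a label to
   the position of its image under [f]. *)
pose g i : 'I_(size b) := Ordinal (lt_b i).
have gE i : lb (g i) = f (la i).
  by rewrite /lb (tnth_nth (f (la i))) /= nth_index.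
exists g; last by move=> x y; rewrite /= -/(lb _) -/(lb _) !gE mult_t.
apply: inj_card_bij => [i j eq_ij|].
  have /inj_f: f (la i) = f (la j) by rewrite -!gE eq_ij.
  move=> /(_ (la_s i) (la_s j)); apply/tuple_uniqP; exact: undup_uniq.
by rewrite !card_ord /= -/b (perm_size perm_b) size_map.
Qed.

Definition relabel (T U : Type) (f : T -> U) (s : seq (T * T)) : seq (U * U) :=
  [seq (f e.1, f e.2) | e <- s].

Lemma endpoints_relabel (T U : eqType) (f : T -> U) s :
  endpoints (relabel f s) = map f (endpoints s).
Proof. by rewrite /endpoints map_flatten -!map_comp. Qed.

Lemma isomorphic_relabel (T U : eqType) (f : T -> U) s :
    {in endpoints s &, injective f} ->
  isomorphic (graph_of_edges s) (graph_of_edges (relabel f s)).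
Proof.
move=> inj_f; apply: (isomorphic_map inj_f).
  by move=> x; rewrite endpoints_relabel.
move=> x y xs ys; rewrite /multiplicity count_map; apply: eq_in_count => -[a b].
move=> /endpoints_edge/andP[/= a_s b_s].
by rewrite /= !xpair_eqE !(inj_in_eq inj_f).
Qed.

Lemma isomorphic_same_edge (T : eqType) (s t : seq (T * T)) :
  all2 (@same_edge T) s t -> isomorphic (graph_of_edges s) (graph_of_edges t).
Proof.
move=> st; apply: (@isomorphic_map _ _ id) => //.
  by move=> x; rewrite map_id (same_edge_endpoints st).
by move=> x y _ _; rewrite (same_edge_multiplicity st).
Qed.

Lemma isomorphic_perm (T : eqType) (s t : seq (T * T)) :
  perm_eq s t -> isomorphic (graph_of_edges s) (graph_of_edges t).
Proof.
move=> st; apply: (@isomorphic_map _ _ id) => //.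
  move=> x; rewrite map_id; apply: perm_mem; apply: perm_flatten.
  by rewrite perm_sym; exact: perm_map.
by move=> x y _ _; rewrite /multiplicity (permP st).
Qed.

Lemma isomorphic_rearrangements (T : eqType) (s t : seq (T * T)) :
  t \in rearrangements s -> isomorphic (graph_of_edges s) (graph_of_edges t).
Proof.
case/flatten_mapP => u; rewrite mem_permutations => us /mem_orientations tu.
apply: isomorphic_trans (isomorphic_sym (isomorphic_same_edge tu)).
by apply: isomorphic_perm; rewrite perm_sym.
Qed.

(** * Canonical labels and enumeration of patterns *)

(* Reversing makes the label of an item depend only on what follows its last
   occurrence, so that labels do not change when [w] is extended in front. *)
Definition label (T : eqType) (w : seq T) (x : T) : nat :=
  index x (rev (undup w)).

Section Label.
Variable T : eqType.
Implicit Type w : seq T.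

Lemma label_inj w : {in w &, injective (label w)}.
Proof.
move=> x y xw yw; rewrite /label => eq_xy.
have mem z : z \in w -> z \in rev (undup w) by rewrite mem_rev mem_undup.
by rewrite -(nth_index x (mem x xw)) -(nth_index x (mem y yw)) eq_xy.
Qed.

Lemma label_cons w x y : y \in w -> label (x :: w) y = label w y.
Proof.
rewrite /label /=; case: ifP => // _ yw.
by rewrite rev_cons -cats1 index_cat mem_rev mem_undup yw.
Qed.

Lemma label_lt w x : x \in w -> label w x < size (undup w).
Proof. by rewrite /label -size_rev index_mem mem_rev mem_undup. Qed.

Lemma label_head w x : label (x :: w) x <= size (undup w).
Proof.
have [xw|xw] := boolP (x \in w); first by rewrite label_cons // ltnW ?label_lt.
have := @label_lt (x :: w) x (mem_head _ _).
by rewrite /= (negPf xw).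
Qed.

End Label.

Definition pattern (T : eqType) (s : seq (T * T)) : seq (nat * nat) :=
  relabel (label (endpoints s)) s.

Lemma isomorphic_pattern (T : eqType) (s : seq (T * T)) :
  isomorphic (graph_of_edges s) (graph_of_edges (pattern s)).
Proof. exact/isomorphic_relabel/label_inj. Qed.

Lemma edge_type_pattern (T : eqType) (s : seq (T * T)) :
  map (@edge_type _) (pattern s) = map (@edge_type _) s.
Proof.
rewrite -map_comp; apply/eq_in_map => e /endpoints_edge/andP[e1 e2].
by rewrite /edge_type /= (inj_in_eq (@label_inj _ _)).
Qed.

Lemma size_endpoints_pattern (T : eqType) (s : seq (T * T)) :
  size (undup (endpoints (pattern s))) = size (undup (endpoints s)).
Proof.
by rewrite endpoints_relabel (perm_size (perm_undup_map (@label_inj _ _))) size_map.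
Qed.

(** By [label_cons], the labels of [s] survive the new edge, so the tail is exactly [pattern s].
    This lets [patterns] proceed by recursion. *)
Lemma pattern_cons (T : eqType) e (s : seq (T * T)) :
  pattern (e :: s) =
  (label (endpoints (e :: s)) e.1, label (e.2 :: endpoints s) e.2) :: pattern s.
Proof.
rewrite /pattern /relabel /=; congr ((_, _) :: _).
  by rewrite [LHS]label_cons ?mem_head.
apply/eq_in_map => f /endpoints_edge/andP[f1 f2].
by rewrite ![label (endpoints (e :: s)) _]label_cons ?inE ?f1 ?f2 ?orbT // !label_cons.
Qed.

(* A new edge is put in front of [s], so its second endpoint [j] is labelled
   first: it is old or the first unused label, and so is [i] once [j] is used. *)
Fixpoint patterns (X : seq index_type) : seq (seq (nat * nat)) :=
  match X with
  | [::] => [:: [::]]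
  | x :: X' =>
    [seq e :: s | s <- patterns X',
       e <- [seq e <- [seq (i, j) | j <- iota 0 (size (undup (endpoints s))).+1,
                         i <- iota 0 (size (undup (j :: endpoints s))).+1]
            | edge_type e == x]]
  end.

Lemma pattern_in_patterns (T : eqType) (s : seq (T * T)) :
  pattern s \in patterns (map (@edge_type _) s).
Proof.
elim: s => [|e s IH] //; rewrite pattern_cons.
set i := label _ _; set j := label _ _.
apply/allpairsPdep; exists (pattern s), (i, j); split=> //.
rewrite mem_filter; apply/andP; split.
  by have := edge_type_pattern (e :: s); rewrite pattern_cons => -[/eqP].
apply/allpairsPdep; exists j, i; split=> //; rewrite mem_iota add0n ltnS leq0n andTb.
  by rewrite size_endpoints_pattern label_head.
(* An injective renaming keeps the number of distinct labels, so the bound on [i] reduces to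
   [label_head] for the original labels. *)
have -> : j :: endpoints (pattern s)
          = map (label (e.2 :: endpoints s)) (e.2 :: endpoints s).
  rewrite /= endpoints_relabel; congr cons; apply/eq_in_map => x xs.
  by rewrite label_cons.
rewrite (perm_size (perm_undup_map (@label_inj _ _))) size_map.
exact: label_head.
Qed.

(** Patterns forget label names but still depend on the order and orientation of the edges;
    rearranging the listed graphs makes up for this and leaves a syntactic, computable
    comparison. *)
Definition exhausts (X : seq index_type) (L : seq (seq (nat * nat))) : bool :=
  all (mem [seq pattern t | s <- L, t <- rearrangements s]) (patterns X).

Lemma exhausts_isomorphic (T : eqType) (t : seq (T * T)) L :
    exhausts (map (@edge_type _) t) L ->
  exists2 s, s \in L & isomorphic (graph_of_edges s) (graph_of_edges t).
Proof.
move/allP/(_ _ (pattern_in_patterns t))/allpairsPdep => [s [u [sL us eq_tu]]].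
exists s => //; apply: isomorphic_trans (isomorphic_rearrangements us) _.
apply: isomorphic_trans (isomorphic_pattern u) _; rewrite -eq_tu.
exact/isomorphic_sym/isomorphic_pattern.
Qed.

(** * Passing between multi-indices and edge lists *)

Lemma order_graph_of_index N X (nu : multi_index N X) :
  Defs.order (graph_of_index nu) <= N.
Proof.
rewrite -[leqRHS](size_enum_ord N); apply: uniq_leq_size (undup_uniq _) _ => x _.
by rewrite mem_enum.
Qed.

Lemma unlabeled_order N X (G : multigraph) :
  unlabeled_graphs N X (unlabeled G) -> Defs.order G <= N.
Proof.
by case=> nu _ /unlabeledP /isomorphic_order <-; exact: order_graph_of_index.
Qed.

Lemma edge_type_of_index N (i : 'I_N + double_index N) :
  edge_type (edge_of_index i) = type_of_index i.
Proof.
case: i => [i|[[i j] /= ij]]; rewrite /edge_type /= ?eqxx //.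
by case: eqP ij => // ->; rewrite ltnn.
Qed.

Lemma edge_types_of_index N X (nu : multi_index N X) :
  map (@edge_type _) (map (@edge_of_index N) (val nu)) = X.
Proof.
rewrite -[RHS](eqP (valP nu)) -map_comp; apply: eq_map => i /=.
exact: edge_type_of_index.
Qed.

(** A double index stores its smaller label first, so an edge written in the other order is
    recovered only up to reversal. *)
Lemma index_of_edge N (e : nat * nat) :
    (e.1 < N) && (e.2 < N) ->
  exists2 i : 'I_N + double_index N,
    type_of_index i = edge_type e &
    same_edge (nat_of_ord (edge_of_index i).1, nat_of_ord (edge_of_index i).2) e.
Proof.
case: e => a b /= /andP[aN bN]; rewrite /same_edge /edge_type /=.
have [ab|ba|<-] := ltngtP a b.
- by exists (inr (exist _ (Ordinal aN, Ordinal bN) ab)); rewrite /= ?eqxx.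
- by exists (inr (exist _ (Ordinal bN, Ordinal aN) ba)); rewrite /= ?eqxx ?orbT.
- by exists (inl (Ordinal aN)); rewrite /= ?eqxx.
Qed.

Lemma indices_of_edges N (s : seq (nat * nat)) :
    all (fun e => (e.1 < N) && (e.2 < N)) s ->
  exists2 nu : seq ('I_N + double_index N),
    map (@type_of_index N) nu = map (@edge_type _) s &
    all2 (@same_edge _) (relabel (@nat_of_ord N) (map (@edge_of_index N) nu)) s.
Proof.
elim: s => [|e s IH] /=; first by exists [::].
case/andP=> /index_of_edge[i ti ei] /IH[nu tnu enu].
by exists (i :: nu); rewrite /= ?ti ?tnu ?ei.
Qed.

(** The labels of [pattern s] are smaller than the number of vertices, hence smaller than [N], and
    can serve as particle labels. *)
Lemma unlabeled_graph_of_edges (T : eqType) (s : seq (T * T)) N :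
    Defs.order (graph_of_edges s) <= N ->
  unlabeled_graphs N (map (@edge_type _) s) (unlabeled (graph_of_edges s)).
Proof.
move=> sN; rewrite -edge_type_pattern.
have : all (fun e : nat * nat => (e.1 < N) && (e.2 < N)) (pattern s).
  apply/allP => _ /mapP[e /endpoints_edge/andP[e1 e2] ->].
  by rewrite !(leq_trans (label_lt _) sN).
case/indices_of_edges => nu tnu snu.
have size_nu : size nu == size (map (@edge_type _) (pattern s)).
  by rewrite -tnu size_map.
have type_nu : map (@type_of_index N) (Tuple size_nu)
               == map (@edge_type _) (pattern s) by rewrite /= tnu.
exists (exist _ (Tuple size_nu) type_nu) => //.
apply/unlabeledP; apply: isomorphic_trans (isomorphic_sym (isomorphic_pattern s)).
apply: isomorphic_trans (isomorphic_same_edge snu).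
by apply: isomorphic_relabel => x y _ _; exact: val_inj.
Qed.

Lemma unlabeled_graphs_trans M N X G :
    Defs.order G <= N ->
  unlabeled_graphs M X (unlabeled G) -> unlabeled_graphs N X (unlabeled G).
Proof.
move=> GN [nu _ eq_nu]; have /isomorphic_order eq_order := (unlabeledP _ _).1 eq_nu.
rewrite -eq_nu -{1}(edge_types_of_index nu).
by apply: unlabeled_graph_of_edges; rewrite [leqLHS]eq_order.
Qed.

(** * Verifying and counting a list of unlabeled graphs *)

Lemma uniq_map_inj_in (T U : eqType) (f : T -> U) (s : seq T) :
  uniq (map f s) -> {in s &, injective f}.
Proof.
move=> uniq_fs x y xs ys eq_fxy; rewrite -(nth_index x xs) -(nth_index x ys).
congr nth; apply/eqP.
rewrite -(nth_uniq (f x) _ _ uniq_fs) ?size_map ?index_mem //.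
by rewrite !(nth_map x) ?index_mem // !nth_index // eq_fxy.
Qed.

(** The three hypotheses are boolean computations that do not mention [N], so one evaluation settles
    every [N], which enters only through the bound on the order. *)
Lemma labelled_by_exhausts X L :
    uniq (map (@edges_invariant _) L) ->
    all (fun s => map (@edge_type _) s == X) L ->
    exhausts X L ->
  forall N, labelled_by N (unlabeled_graphs N X) L.
Proof.
move=> uniq_L /allP type_L exh N; split.
- exact: map_uniq uniq_L.
- move=> s t sL tL /isomorphic_invariant; rewrite !graph_of_edges_invariant.
  exact: (uniq_map_inj_in uniq_L).
apply/seteqP; split=> [_ [nu _ <-]|_ [s [sL sN] <-]]; last first.
  by rewrite -(eqP (type_L s sL)); exact: unlabeled_graph_of_edges.
rewrite -(edge_types_of_index nu) in exh.
have [s sL iso_s] := exhausts_isomorphic exh.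
exists s; last exact/unlabeledP.
split=> //; rewrite (isomorphic_order iso_s); exact: order_graph_of_index.
Qed.

Lemma finite_unlabeled_graphs N X : finite_set (unlabeled_graphs N X).
Proof. by apply: finite_image; exact: finite_finset. Qed.

Lemma card_labelled_by N (A : set (set multigraph)) L :
    finite_set A -> labelled_by N A L ->
  #|` fset_set A| = count (fun s => Defs.order (graph_of_edges s) <= N) L.
Proof.
move=> finA [uniq_L iso_L eqA]; rewrite -size_filter.
rewrite -(size_map (fun s => unlabeled (graph_of_edges s))).
apply/perm_size/uniq_perm; rewrite ?fset_uniq //.
  rewrite map_inj_in_uniq ?filter_uniq // => s t.
  rewrite !mem_filter => /andP[_ sL] /andP[_ tL] /unlabeledP.
  exact: iso_L.
move=> C; rewrite in_fset_set // {1}eqA; apply/idP/mapP.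
  rewrite inE => -[s [sL sN] <-]; exists s => //.
  by rewrite mem_filter sN.
case=> s; rewrite mem_filter => /andP[sN sL] ->.
by rewrite inE; exists s.
Qed.

(** * Linear independence of the binary invariants *)

(** Evaluating a vanishing linear combination at the point [i] attached to [v] leaves only the
    coefficient of [v]. *)
Lemma free_ffun (K : fieldType) (I : finType) (s : seq {ffun I -> K^o}) :
    uniq s ->
    (forall v, v \in s -> exists i, forall w, w \in s -> w i = (w == v)%:R%R) ->
  free s.
Proof.
move=> uniq_s sep; rewrite -[s]in_tupleE; apply/freeP => k sum0 j.
have sj : (s`_j)%R \in s by exact: mem_nth.
have [i si] := sep _ sj.
move/ffunP/(_ i): sum0; rewrite sum_ffunE ffunE (bigD1 j) //= big1.
  by rewrite ffunE si // eqxx addr0 /GRing.scale /= mulr1.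
move=> l lj; rewrite ffunE si ?mem_nth // nth_uniq //.
by rewrite (inj_eq val_inj) (negPf lj) /GRing.scale /= mulr0.
Qed.

Section BinaryInvariants.
Variables (R : realType) (N : nat) (X : seq index_type).

Lemma binary_invariantE (C : set multigraph) (nu : multi_index N X) :
    C \in unlabeled_graphs N X ->
  binary_invariant R N X C nu = (C == unlabeled (graph_of_index nu))%:R%R.
Proof.
rewrite inE => -[mu _ <-]; rewrite ffunE; congr (nat_of_bool _)%:R%R.
by apply/idP/eqP => [/set_mem/unlabeledP|/unlabeledP/mem_set].
Qed.

(** At a multi-index whose graph represents [C], the invariant of [C] is 1, while that of [D] is 1
    only if [D = C]. *)
Lemma binary_invariant_inj :
  {in unlabeled_graphs N X &, injective (@binary_invariant R N X)}.
Proof.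
move=> C D CX DX eqCD; have := CX; rewrite inE => -[nu _ eqC].
have := binary_invariantE nu DX; rewrite -eqCD binary_invariantE // eqC eqxx.
by case: eqP => // _ /eqP; rewrite oner_eq0.
Qed.

Lemma free_binary_invariants : free (binary_invariants R N X).
Proof.
have fin_b := finite_image (@binary_invariant R N X) (finite_unlabeled_graphs N X).
apply: free_ffun => [|v]; first exact: fset_uniq.
rewrite in_fset_set // inE => -[_ [nu _ <-] <-]; exists nu => w.
rewrite in_fset_set // inE => -[C CX <-].
rewrite binary_invariantE ?inE // (inj_in_eq binary_invariant_inj) ?inE //.
by exists nu.
Qed.

Lemma dim_binary_invariants :
  \dim <<binary_invariants R N X>> = #|` fset_set (unlabeled_graphs N X)|.
Proof.
rewrite (eqP free_binary_invariants) /binary_invariants fset_set_image; last first.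
  exact: finite_unlabeled_graphs.
apply: card_in_imfset => C D /=; rewrite !in_fset_set; try exact: finite_unlabeled_graphs.
exact: binary_invariant_inj.
Qed.

End BinaryInvariants.

(** * Dependence of the count on the number of particles *)

Lemma num_independentE R N n :
  num_independent R N n =
  \sum_(k < n.+1) #|` fset_set (unlabeled_graphs N (block n k))|.
Proof. by apply: eq_bigr => k _; exact: dim_binary_invariants. Qed.

Lemma size_block n k : k <= n -> size (block n k) = n.
Proof. by move=> kn; rewrite size_cat !size_nseq subnKC. Qed.

Lemma size_endpoints (T : eqType) (s : seq (T * T)) :
  size (endpoints s) = (size s).*2.
Proof. by elim: s => //= e s IH; rewrite /endpoints /= -/(endpoints s) IH. Qed.

Lemma order_graph_of_index_double N X (nu : multi_index N X) :
  Defs.order (graph_of_index nu) <= (size X).*2.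
Proof.
by apply: leq_trans (size_undup _) _; rewrite size_endpoints size_map size_tuple.
Qed.

(** A graph occurring with [M] labels has at most [M] vertices and at most two per index; either
    bound allows it to be realized with [N] labels. *)
Lemma unlabeled_graphs_sub M N X :
  (M <= N) || ((size X).*2 <= N) ->
  (unlabeled_graphs M X `<=` unlabeled_graphs N X)%classic.
Proof.
move=> MN _ [nu _ <-]; apply: (@unlabeled_graphs_trans M); last by exists nu.
have [/(leq_trans (order_graph_of_index nu))//|] := orP MN.
exact/leq_trans/order_graph_of_index_double.
Qed.

Lemma num_independent_stable R N n :
  n.*2 <= N -> num_independent R N n = num_independent R n.*2 n.
Proof.
move=> nN; rewrite !num_independentE; apply: eq_bigr => k _.
have kn : k <= n by rewrite -ltnS.
by congr #|` fset_set _|; apply/seteqP; split; apply: unlabeled_graphs_sub;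
  rewrite size_block ?nN ?leqnn ?orbT.
Qed.

Definition matching n : seq (nat * nat) := [seq (i.*2, i.*2.+1) | i <- iota 0 n].

Lemma edge_type_matching n : map (@edge_type _) (matching n) = block n n.
Proof.
rewrite /block subnn cats0 -map_comp -[in RHS](size_iota 0 n).
elim: (iota 0 n) => //= i s ->; congr (_ :: _).
by rewrite /edge_type /= ltn_eqF.
Qed.

Lemma order_matching n : Defs.order (graph_of_edges (matching n)) = n.*2.
Proof.
(* The starting point [m] is generalized because the induction shifts it. *)
have endpointsE m : endpoints [seq (i.*2, i.*2.+1) | i <- iota m n] = iota m.*2 n.*2.
  by elim: n m => [|n IH] m //; rewrite [LHS]/= /endpoints /= -/(endpoints _) IH.
by rewrite /= endpointsE undup_id ?iota_uniq ?size_iota.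
Qed.

Lemma num_independent_lt R N n :
  N < n.*2 -> num_independent R N n < num_independent R n.*2 n.
Proof.
(* The last summand, the block of [n] double indices, is split off: it supplies the strict
   inequality, and the other summands a weak one. *)
move=> Nn; rewrite !num_independentE !big_ord_recr /= -addnS leq_add //.
  apply: leq_sum => k _; apply: fsubset_leq_card.
  rewrite -fset_set_sub; try exact: finite_unlabeled_graphs.
  by apply: unlabeled_graphs_sub; rewrite (ltnW Nn).
apply: fproper_ltn_card; rewrite fproperE; apply/andP; split.
  rewrite -fset_set_sub; try exact: finite_unlabeled_graphs.
  by apply: unlabeled_graphs_sub; rewrite (ltnW Nn).
apply/negP; rewrite -fset_set_sub; try exact: finite_unlabeled_graphs.
move=> sub.
have : unlabeled_graphs n.*2 (block n n) (unlabeled (graph_of_edges (matching n))).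
  by rewrite -edge_type_matching; apply: unlabeled_graph_of_edges; rewrite order_matching.
by move/sub/unlabeled_order; rewrite order_matching leqNgt Nn.
Qed.

(** * The explicit lists in ranks two and three *)

Lemma labelled_rr N : labelled_by N (unlabeled_graphs N [:: Single; Single]) graphs_rr.
Proof. by apply: labelled_by_exhausts; vm_compute. Qed.

Lemma labelled_gr N : labelled_by N (unlabeled_graphs N [:: Double; Single]) graphs_gr.
Proof. by apply: labelled_by_exhausts; vm_compute. Qed.

Lemma labelled_gg N : labelled_by N (unlabeled_graphs N [:: Double; Double]) graphs_gg.
Proof. by apply: labelled_by_exhausts; vm_compute. Qed.

Lemma labelled_rrr N :
  labelled_by N (unlabeled_graphs N [:: Single; Single; Single]) graphs_rrr.
Proof. by apply: labelled_by_exhausts; vm_compute. Qed.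

Lemma labelled_grr N :
  labelled_by N (unlabeled_graphs N [:: Double; Single; Single]) graphs_grr.
Proof. by apply: labelled_by_exhausts; vm_compute. Qed.

Lemma labelled_ggr N :
  labelled_by N (unlabeled_graphs N [:: Double; Double; Single]) graphs_ggr.
Proof. by apply: labelled_by_exhausts; vm_compute. Qed.

Lemma labelled_ggg N :
  labelled_by N (unlabeled_graphs N [:: Double; Double; Double]) graphs_ggg.
Proof. by apply: labelled_by_exhausts; vm_compute. Qed.

(** With 4 labels no listed graph is too large, so the count is 2 + 2 + 3, the lengths of the
    lists. *)
Lemma num_independent2 R : num_independent R 4 2 = 7.
Proof.
rewrite num_independentE !big_ord_recr big_ord0 /=.
rewrite (card_labelled_by (finite_unlabeled_graphs _ _) (labelled_rr 4)).
rewrite (card_labelled_by (finite_unlabeled_graphs _ _) (labelled_gr 4)).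
by rewrite (card_labelled_by (finite_unlabeled_graphs _ _) (labelled_gg 4)).
Qed.

(** With 6 labels the lists again count in full: 3 + 5 + 7 + 8. *)
Lemma num_independent3 R : num_independent R 6 3 = 23.
Proof.
rewrite num_independentE !big_ord_recr big_ord0 /=.
rewrite (card_labelled_by (finite_unlabeled_graphs _ _) (labelled_rrr 6)).
rewrite (card_labelled_by (finite_unlabeled_graphs _ _) (labelled_grr 6)).
rewrite (card_labelled_by (finite_unlabeled_graphs _ _) (labelled_ggr 6)).
by rewrite (card_labelled_by (finite_unlabeled_graphs _ _) (labelled_ggg 6)).
Qed.

Theorem mainTheorem2 (R : realType) :
  (forall (N : nat) (X : seq index_type),
     {in unlabeled_graphs N X &, injective (@binary_invariant R N X)} /\
     free (binary_invariants R N X)) /\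
  (forall n : nat, exists N0 c : nat, forall N : nat,
     ((N0 <= N)%N -> num_independent R N n = c) /\
     ((N < N0)%N -> (num_independent R N n < c)%N)) /\
  (forall N : nat,
     ((4 <= N)%N -> num_independent R N 2 = 7%N) /\
     ((N < 4)%N -> (num_independent R N 2 < 7)%N)) /\
  (forall N : nat,
     ((6 <= N)%N -> num_independent R N 3 = 23%N) /\
     ((N < 6)%N -> (num_independent R N 3 < 23)%N)) /\
  (forall N : nat,
     labelled_by N (unlabeled_graphs N [:: Single; Single]) graphs_rr /\
     labelled_by N (unlabeled_graphs N [:: Double; Single]) graphs_gr /\
     labelled_by N (unlabeled_graphs N [:: Double; Double]) graphs_gg) /\
  (forall N : nat,
     labelled_by N (unlabeled_graphs N [:: Single; Single; Single]) graphs_rrr /\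
     labelled_by N (unlabeled_graphs N [:: Double; Single; Single]) graphs_grr /\
     labelled_by N (unlabeled_graphs N [:: Double; Double; Single]) graphs_ggr /\
     labelled_by N (unlabeled_graphs N [:: Double; Double; Double]) graphs_ggg).
Proof.
split; first by move=> N X; split;
  [exact: binary_invariant_inj | exact: free_binary_invariants].
split.
  move=> n; exists n.*2, (num_independent R n.*2 n) => N.
  by split; [exact: num_independent_stable | exact: num_independent_lt].
split.
  (* Once 7 is replaced by the count at [N = 4], this is the general statement for [n = 2], as
     [2.*2] computes to 4. *)
  by move=> N; rewrite -(num_independent2 R);
    split; [exact: (@num_independent_stable R N 2) | exact: (@num_independent_lt R N 2)].
split.
  by move=> N; rewrite -(num_independent3 R);
    split; [exact: (@num_independent_stable R N 3) | exact: (@num_independent_lt R N 3)].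
split=> N; first by split; [exact: labelled_rr | split; [exact: labelled_gr | exact: labelled_gg]].
split; first exact: labelled_rrr.
split; first exact: labelled_grr.
by split; [exact: labelled_ggr | exact: labelled_ggg].
Qed.
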